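(* Fix $\beta>0$. For each $L>0$ let $$A_{2,L,\beta}:=\Big\{b\in L^1_{\rm loc}(\mathbb{R})\ \Big|\ b(\cdot+L)=b(\cdot),\ b\ge 0,\ \frac1L\int_0^L b^2\,dx=\beta\Big\}$$ and let $b_L\in A_{2,L,\beta}$ satisfy $c^*(b_L)=\max_{b\in A_{2,L,\beta}}c^*(b)$. Then for any $k\in\mathbb{N}$, $$\big\|b_L-\sqrt{\beta}\big\|_{C^2}=O(L^k)\quad\text{as } L\to0.$$
   Context: For $\lambda\in\mathbb{R}$ and a real $L$-periodic function $b\in L^1_{\rm loc}(\mathbb{R})$, $k(\lambda,b)\in\mathbb{R}$ denotes the principal eigenvalue of $-L_{\lambda,b}\psi:=-\psi''-2\lambda\psi'-(b(x)+\lambda^2)\psi$ on $\mathbb{R}/L\mathbb{Z}$, i.e. the unique real number for which $-L_{\lambda,b}\psi=k(\lambda,b)\psi$ has an $L$-periodic positive solution $\psi$. For $b\ge0$, $b\not\equiv0$, the minimal speed of pulsating traveling waves of $u_t=u_{xx}+b(x)(1-u)u$ (with $b$ $L$-periodic) is $c^*(b)=\min_{\lambda>0}\frac{-k(\lambda,b)}{\lambda}$. Functions are identified when equal almost everywhere; $\|w\|_{C^2}=\|w\|_{L^\infty}+\|w'\|_{L^\infty}+\|w''\|_{L^\infty}$. *)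

(* Defs.v *)
From HB Require Import structures.
From mathcomp Require Import all_boot all_order all_algebra.
From mathcomp Require Import all_classical all_reals all_analysis.

Set Implicit Arguments.
Unset Strict Implicit.
Unset Printing Implicit Defensive.

Import Order.TTheory GRing.Theory Num.Theory.
Import numFieldNormedType.Exports.
Local Open Scope classical_set_scope.
Local Open Scope ring_scope.

(* Elements of L^1_loc are represented by functions, and every condition on
   them is required only almost everywhere. *)
Definition ae_periodic (R : realType) (L : R) (b : R -> R) : Prop :=
  {ae (@lebesgue_measure R), forall x : R, b (x + L) = b x}.

(* psi is (the C^1 representative of) a W^{2,1}_loc function with second weak
   derivative psi'': psi is differentiable, and psi' is an indefinite
   integral of the locally integrable function psi''. *)
Definition has_second_derivative (R : realType) (psi psi'' : R -> R) : Prop :=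
  [/\ forall x, derivable psi x 1,
      locally_integrable setT psi'' &
      forall x y, x <= y ->
        derive1 psi y - derive1 psi x
          = \int[@lebesgue_measure R]_(t in `[x, y]) psi'' t].

Definition is_principal_eigenvalue (R : realType) (L lambda : R) (b : R -> R)
    (k : R) : Prop :=
  exists psi psi'' : R -> R,
    [/\ has_second_derivative psi psi'',
        forall x, psi (x + L) = psi x,
        forall x, 0 < psi x &
        {ae (@lebesgue_measure R), forall x : R,
          - psi'' x - 2 * lambda * derive1 psi x - (b x + lambda ^+ 2) * psi x
            = k * psi x}].

(* The value 0 is a dummy, returned only if no principal eigenvalue exists. *)
Definition principal_eigenvalue (R : realType) (L lambda : R) (b : R -> R) : R :=
  xget 0 [set k | is_principal_eigenvalue L lambda b k].

Definition speed_set (R : realType) (L : R) (b : R -> R) : set R :=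
  [set - principal_eigenvalue L lambda b / lambda | lambda in [set l | 0 < l]].

(* The minimum of [speed_set L b] (dummy value 0 if it is not attained). *)
Definition minimal_speed (R : realType) (L : R) (b : R -> R) : R :=
  xget 0 (speed_set L b `&` lbound (speed_set L b)).

Definition A2 (R : realType) (L beta : R) : set (R -> R) :=
  [set b | [/\ locally_integrable setT b,
               ae_periodic L b,
               {ae (@lebesgue_measure R), forall x : R, 0 <= b x} &
               ((L^-1)%:E * \int[@lebesgue_measure R]_(x in `[0%R, L])
                  ((b x) ^+ 2)%:E = beta%:E)%E]].

Definition is_speed_maximizer (R : realType) (L beta : R) (b : R -> R) : Prop :=
  A2 L beta b /\
  forall b', A2 L beta b' -> minimal_speed L b' <= minimal_speed L b.

Definition Linfty_norm (R : realType) (w : R -> R) : \bar R :=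
  Lnorm (@lebesgue_measure R) +oo%E (EFin \o w).

Definition is_C2 (R : realType) (w : R -> R) : Prop :=
  [/\ forall x, derivable w x 1,
      forall x, derivable (derive1 w) x 1 &
      continuous (derive1n 2 w)].

(* The C^2 norm of an almost-everywhere class: a class has at most one C^2
   representative, so the infimum is over at most one value; it is +oo when
   there is no such representative. *)
Definition C2_norm (R : realType) (u : R -> R) : \bar R :=
  ereal_inf [set (Linfty_norm w + Linfty_norm (derive1 w)
                   + Linfty_norm (derive1n 2 w))%E
            | w in [set w | is_C2 w /\
                {ae (@lebesgue_measure R), forall x : R, w x = u x}]].

(* Main.v *)
(* For small [L] the maximizer is exactly the constant [sqrt beta].  Write
   [phi = psi' / psi] for a principal eigenfunction [psi], [m] for the mean of
   [b] and [A = - k - lambda ^ 2 - m].  Then [phi' = q - (b - m)] with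
   [q = A - 2 lambda phi - phi ^ 2].  As [phi] is periodic with mean zero,
   integrating this identity gives [A = mean (phi ^ 2)], and
   [q phi'] is an exact derivative, so that
   [mean ((b - m) ^ 2) = mean (q ^ 2) + mean (phi' ^ 2)].  Since [phi] vanishes
   somewhere, Cauchy-Schwarz gives
     [lambda ^ 2 + m <= - k <= lambda ^ 2 + m + L ^ 2 (beta - m ^ 2)].
   Comparing [b] with the constant [sqrt beta] at [lambda = beta ^ (1/4)], where
   the minimal speed of the latter is attained, forces
   [sqrt beta <= m + L ^ 2 (beta - m ^ 2)], hence [m = sqrt beta] as soon as
   [2 L ^ 2 sqrt beta < 1], and then [b] has zero variance. *)

Require Import Defs.
From HB Require Import structures.
From mathcomp Require Import all_boot all_order all_algebra.
From mathcomp Require Import all_classical all_reals all_analysis.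
From mathcomp Require Import measurable_realfun.
From mathcomp Require Import ring lra.
Set Implicit Arguments.
Unset Strict Implicit.
Import Order.TTheory GRing.Theory Num.Theory.
Import numFieldNormedType.Exports.
Local Open Scope classical_set_scope.
Local Open Scope ring_scope.

(** * Calculus of absolutely continuous functions on a segment *)

Section indefinite_integral.
Context {R : realType}.
Notation mu := (@lebesgue_measure R).

(** Fubini on the triangle [a <= s <= t <= b]: both sides integrate [f t * g s] over it, in the two
    orders. It is the source of the product rule [is_primitiveM]. *)
Lemma Rintegral_triangle (a b : R) (f g : R -> R) :
  mu.-integrable `[a, b] (EFin \o f) -> mu.-integrable `[a, b] (EFin \o g) ->
  \int[mu]_(t in `[a, b]) (f t * \int[mu]_(s in `[a, t]) g s) =
  \int[mu]_(s in `[a, b]) (g s * \int[mu]_(t in `[s, b]) f t).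
Proof.
move=> intf intg.
have Rint_restr (h : R -> R) : mu.-integrable `[a, b] (EFin \o h) ->
    mu.-integrable setT (EFin \o (h \_ `[a, b])).
  by move=> inth; rewrite -restrict_EFin; apply/(integrable_mkcond _ _).1.
pose F := f \_ `[a, b]; pose G := g \_ `[a, b].
have iF : mu.-integrable setT (EFin \o F) by exact: Rint_restr.
have iG : mu.-integrable setT (EFin \o G) by exact: Rint_restr.
have mF : measurable_fun setT F by apply/measurable_EFinP; exact: measurable_int iF.
have mG : measurable_fun setT G by apply/measurable_EFinP; exact: measurable_int iG.
(* The integrand on the triangle, extended by zero to the whole plane; [p.1] is [t] and [p.2] is
   [s]. *)
pose K (p : R * R) : R := if p.2 <= p.1 then F p.1 * G p.2 else 0.
have mK : measurable_fun setT (EFin \o K).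
  apply/measurable_EFinP; apply: measurable_fun_ifT => //.
    by apply: measurable_fun_ler => //.
  apply: measurable_funM; exact: measurableT_comp.
have iK : (mu \x mu)%E.-integrable setT (EFin \o K).
  apply/(integrable12ltyP _ _ _).2 => //.
  have mabs (h : R -> R) : measurable_fun setT h ->
      measurable_fun setT (fun x => (`|h x|)%:E).
    by move=> mh; apply/measurable_EFinP; exact: measurableT_comp.
  have ilt (h : R -> R) : mu.-integrable setT (EFin \o h) ->
      (\int[mu]_x (`|h x|)%:E < +oo)%E.
    by move=> /integrableP[].
  (* Tonelli with [|K (t, s)| <= |F t| * |G s|], whose double integral is a product of two finite
     integrals. *)
  apply: (@le_lt_trans _ _ (\int[mu]_t (`|F t|%:E * \int[mu]_s (`|G s|)%:E))%E).
    apply: ge0_le_integral => //.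
    - by move=> x _; exact: integral_ge0.
    - apply: (@measurable_fun_fubini_tonelli_F _ _ _ _ _ mu (abse \o (EFin \o K)) _ _).
        exact: measurableT_comp.
      by move=> p; exact: abse_ge0.
    - apply: emeasurable_funM => //; exact: mabs.
    - move=> t _; rewrite -ge0_integralZl//; last exact: mabs.
      apply: ge0_le_integral => //.
      + apply: measurableT_comp => //; apply: (measurableT_comp mK) => //.
      + by apply: emeasurable_funM => //; exact: mabs.
      + move=> s _; rewrite /K /= -EFinM lee_fin; case: ifP => _.
          by rewrite normrM.
        by rewrite normr0 mulr_ge0.
  rewrite ge0_integralZr//; last 2 first.
    exact: mabs.
    exact: integral_ge0.
  by rewrite lte_mul_pinfty ?ilt// ?integral_ge0// ge0_fin_numE ?ilt// integral_ge0.
have := Fubini iK.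
have sub1 t : t \in `[a, b] -> `[a, t]%classic `<=` `[a, b]%classic.
  by rewrite in_itv/= => /andP[_ tb]; apply: subset_itvl; rewrite bnd_simp.
have sub2 s : s \in `[a, b] -> `[s, b]%classic `<=` `[a, b]%classic.
  by rewrite in_itv/= => /andP[sa _]; apply: subset_itvr; rewrite bnd_simp.
have inner1 t : (\int[mu]_s (EFin \o K) (t, s) =
    ((fun t => f t * \int[mu]_(s in `[a, t]) g s) \_ `[a, b] t)%:E)%E.
  rewrite patchE; case: ifPn => tab; last first.
    under eq_integral => s _ do
      rewrite /K /= /F patchE (negbTE tab) mul0r if_same.
    by rewrite integral0.
  move: tab; rewrite inE/= => tab.
  have igt : mu.-integrable `[a, t] (EFin \o g).
    by apply: integrableS intg => //; exact: sub1.
  rewrite EFinM /Rintegral fineK ?integrable_fin_num//.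
  rewrite -integralZl// integral_mkcond; apply: eq_integral => s _.
  rewrite /K /= patchE /F /G !patchE mem_set//= !mem_setE !in_itv/=.
  move: (tab); rewrite in_itv/= => /andP[ta tb].
  case: (leP s t) => st; last by rewrite andbF.
  by rewrite (le_trans st tb) !andbT; case: ifP => // _; rewrite mulr0.
have inner2 s : (\int[mu]_t (EFin \o K) (t, s) =
    ((fun s => g s * \int[mu]_(t in `[s, b]) f t) \_ `[a, b] s)%:E)%E.
  rewrite patchE; case: ifPn => sab; last first.
    under eq_integral => t _ do
      rewrite /K /= /G patchE (negbTE sab) mulr0 if_same.
    by rewrite integral0.
  move: sab; rewrite inE/= => sab.
  have ifs : mu.-integrable `[s, b] (EFin \o f).
    by apply: integrableS intf => //; exact: sub2.
  rewrite EFinM /Rintegral fineK ?integrable_fin_num//.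
  rewrite -integralZl// integral_mkcond; apply: eq_integral => t _.
  rewrite /K /= patchE /F /G !patchE !mem_setE sab !in_itv/=.
  move: (sab); rewrite in_itv/= => /andP[sa sb].
  case: (leP s t) => st //=.
  rewrite (le_trans sa st) /=; case: ifP => _; first by rewrite mulrC.
  by rewrite mul0r.
move=> H; rewrite Rintegral_mkcond [RHS]Rintegral_mkcond /Rintegral; congr fine.
under eq_integral => t _ do rewrite -inner1.
by rewrite H; apply: eq_integral => s _; rewrite inner2.
Qed.

Lemma integrable_itvD (i : interval R) (f g : R -> R) :
  mu.-integrable [set` i] (EFin \o f) -> mu.-integrable [set` i] (EFin \o g) ->
  mu.-integrable [set` i] (EFin \o (fun t => f t + g t)).
Proof.
by move=> intf intg; apply: eq_integrable (integrableD _ intf intg) => //.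
Qed.

Lemma integrable_itvZ (i : interval R) (c : R) (f : R -> R) :
  mu.-integrable [set` i] (EFin \o f) ->
  mu.-integrable [set` i] (EFin \o (fun t => c * f t)).
Proof.
by move=> intf; apply: eq_integrable (integrableZl _ c intf) => //.
Qed.

Lemma integrable_itvB (i : interval R) (f g : R -> R) :
  mu.-integrable [set` i] (EFin \o f) -> mu.-integrable [set` i] (EFin \o g) ->
  mu.-integrable [set` i] (EFin \o (fun t => f t - g t)).
Proof.
by move=> intf intg; apply: eq_integrable (integrableB _ intf intg) => //.
Qed.

(* [f] is absolutely continuous on [[a, b]] with a.e. derivative [f']. *)
Definition is_primitive (a b : R) (f f' : R -> R) :=
  mu.-integrable `[a, b] (EFin \o f') /\
  forall x, x \in `[a, b] -> f x - f a = \int[mu]_(t in `[a, x]) f' t.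

Lemma is_primitiveB (a b : R) (f f' : R -> R) (x y : R) :
  is_primitive a b f f' -> a <= x -> x <= y -> y <= b ->
  f y - f x = \int[mu]_(t in `[x, y]) f' t.
Proof.
move=> [intf Hf] ax xy yb.
have iay : mu.-integrable `[a, y] (EFin \o f').
  by apply: integrableS intf => //; apply: subset_itvl; rewrite bnd_simp.
rewrite -Rintegral_itv_obnd_cbnd; last first.
  by apply: integrableS iay => //; apply: subset_itvr; rewrite bnd_simp.
rewrite -(@Rintegral_itvB _ f' (BLeft a) (BRight y) x)//.
rewrite -!Hf ?in_itv/= ?ax ?yb ?(le_trans ax xy) ?(le_trans xy yb)//.
by rewrite opprB addrA subrK.
Qed.

Lemma is_primitive_continuous (a b : R) (f f' : R -> R) : a <= b ->
  is_primitive a b f f' -> {within `[a, b], continuous f}.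
Proof.
move=> ab [intf Hf].
have := parameterized_integral_continuous ab intf.
have /subspace_eq_continuous : {in `[a, b]%classic,
    (fun x => f a + \int[mu]_(t in `[a, x]) f' t) =1 f}.
  by move=> x; rewrite inE/= => xab; rewrite -Hf// addrC subrK.
move=> H C; apply: H => x.
apply: (@continuousD _ _ _ (cst (f a) : subspace `[a, b] -> R)).
  exact: cst_continuous.
exact: C.
Qed.

Lemma integrable_continuousM (a b : R) (g f : R -> R) :
  {within `[a, b], continuous g} -> mu.-integrable `[a, b] (EFin \o f) ->
  mu.-integrable `[a, b] (EFin \o (fun t => g t * f t)).
Proof.
move=> cg intf.
have /compact_bounded[M [Mreal HM]] := continuous_compact cg (@segment_compact _ a b).
have : mu.-integrable `[a, b] ((EFin \o g) \* (EFin \o f))%E.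
  apply: integrableMr => //.
    exact: subspace_continuous_measurable_fun.
  by exists M; split => // x Mx y /= yab; apply: HM => //; exists y.
by apply: eq_integrable => //.
Qed.

(** Integration by parts without pointwise derivatives: one factor is expanded from the left end and
    the other from the right end, and the two double integrals that remain cancel by
    [Rintegral_triangle]. *)
Lemma is_primitiveM (a b : R) (f f' g g' : R -> R) : a <= b ->
  is_primitive a b f f' -> is_primitive a b g g' ->
  is_primitive a b (fun t => f t * g t) (fun t => f' t * g t + f t * g' t).
Proof.
move=> ab Hf Hg.
have cf := is_primitive_continuous ab Hf; have cg := is_primitive_continuous ab Hg.
have [intf Hf'] := Hf; have [intg Hg'] := Hg.
have ifg : mu.-integrable `[a, b] (EFin \o (fun t => f' t * g t)).
  apply: eq_integrable (integrable_continuousM cg intf) => //= t _.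
  by rewrite mulrC.
have igf := integrable_continuousM cf intg.
split.
  exact: integrable_itvD.
move=> x xab.
have sub : `[a, x]%classic `<=` `[a, b]%classic.
  by apply: subset_itvl; move: xab; rewrite bnd_simp in_itv/= => /andP[].
have iS h : mu.-integrable `[a, b] (EFin \o h) -> mu.-integrable `[a, x] (EFin \o h).
  by apply: integrableS.
rewrite RintegralD ?iS//.
have ax : a <= x by move: xab; rewrite in_itv => /andP[].
have xb : x <= b by move: xab; rewrite in_itv => /andP[].
(* Here [g t] is replaced by [g a] plus the integral of [g'] over [[a, t]]. *)
have T1 : \int[mu]_(t in `[a, x]) (f' t * g t) =
   (f x - f a) * g a + \int[mu]_(t in `[a, x]) (f' t * \int[mu]_(s in `[a, t]) g' s).
  rewrite Hf'// -RintegralZr ?iS// -RintegralD//; last 2 first.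
  - apply: eq_integrable (integrable_itvZ (g a) (iS _ intf)) => //= t _.
    by rewrite mulrC.
  - apply: eq_integrable (integrable_itvB (iS _ ifg)
      (integrable_itvZ (g a) (iS _ intf))) => // t.
    rewrite inE/= in_itv/= => /andP[at_ tx].
    by rewrite -Hg' ?in_itv/= ?at_ ?(le_trans tx xb)// mulrBr [g a * _]mulrC.
  apply: eq_Rintegral => t; rewrite inE/= in_itv/= => /andP[at_ tx].
  by rewrite -Hg' ?in_itv/= ?at_ ?(le_trans tx xb)// mulrBr addrC subrK.
(* Here [f t] is replaced by [f x] minus the integral of [f'] over [[t, x]]. *)
have T2 : \int[mu]_(t in `[a, x]) (f t * g' t) =
   f x * (g x - g a) - \int[mu]_(s in `[a, x]) (g' s * \int[mu]_(t in `[s, x]) f' t).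
  have E s : s \in `[a, x] -> \int[mu]_(t in `[s, x]) f' t = f x - f s.
    rewrite in_itv/= => /andP[as_ sx].
    by rewrite (is_primitiveB Hf).
  rewrite Hg'// -RintegralZl ?iS// -RintegralB//; last 2 first.
  - exact/integrable_itvZ/iS.
  - apply: eq_integrable (integrable_itvB
      (integrable_itvZ (f x) (iS _ intg)) (iS _ igf)) => // t.
    rewrite inE/= => tax.
    by rewrite E// mulrBr [g' t * f x]mulrC [g' t * f t]mulrC.
  apply: eq_Rintegral => t; rewrite inE/= => tax.
  by rewrite E// mulrBr [g' t * f x]mulrC [g' t * f t]mulrC opprB addrC subrK.
rewrite T1 T2 (Rintegral_triangle (iS _ intf) (iS _ intg)).
ring.
Qed.

(** Allows the derivative to be rewritten with an equation that holds only almost everywhere, such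
    as the eigenvalue equation. *)
Lemma is_primitive_ae (a b : R) (f f1 f2 : R -> R) :
  is_primitive a b f f1 -> measurable_fun `[a, b] f2 ->
  {ae mu, forall x, x \in `[a, b] -> f1 x = f2 x} ->
  is_primitive a b f f2.
Proof.
move=> [int1 Hf] m2 ae12; split.
  apply/integrableP; split; first exact/measurable_EFinP.
  case/integrableP: int1 => m1.
  rewrite (@ae_eq_integral _ _ _ mu _ (fun x => (`|(EFin \o f2) x|)%E))//.
  - exact: measurableT_comp.
  - by apply: measurableT_comp => //; exact/measurable_EFinP.
  - apply: filterS ae12; first exact: (ae_filter_ringOfSetsType mu).
    by move=> x H xab /=; rewrite H.
move=> x xab.
have sub : `[a, x]%classic `<=` `[a, b]%classic.
  by apply: subset_itvl; move: xab; rewrite bnd_simp in_itv/= => /andP[].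
rewrite Hf// /Rintegral; congr fine; apply: ae_eq_integral => //.
- apply: measurable_funS sub _ => //; exact: measurable_int int1.
- by apply: measurable_funS sub _ => //; exact/measurable_EFinP.
- apply: filterS ae12; first exact: (ae_filter_ringOfSetsType mu).
  by move=> t H /sub tab /=; rewrite H.
Qed.

Lemma is_primitive_C1 (a b : R) (f f' : R -> R) :
  (forall x : R, is_derive x (1 : R) f (f' x)) -> {within `[a, b], continuous f'} ->
  is_primitive a b f f'.
Proof.
move=> dff' cf.
have df x : derivable f x 1 by have [] := dff' x.
have f'E : derive1 f = f'.
  by apply/funext => x; rewrite derive1E; have [_ ->] := dff' x.
rewrite -f'E in cf *; split.
  by apply: continuous_compact_integrable => //; exact: segment_compact.
move=> x; rewrite in_itv/= => /andP[].
rewrite le_eqVlt => /predU1P[<- _|ax xb].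
  by rewrite subrr set_itv1 Rintegral_set1.
have cfx y : {for y, continuous f}.
  by apply: differentiable_continuous; exact/derivable1_diffP.
have LR : derivable_oo_LRcontinuous f a x.
  split => [y _||]; first exact: df.
  - by apply: cvg_at_right_filter; exact: cfx.
  - by apply: cvg_at_left_filter; exact: cfx.
have cfx' : {within `[a, x], continuous (derive1 f)}.
  by apply: continuous_subspaceW cf; apply: subset_itvl; rewrite bnd_simp.
have := continuous_FTC2 ax cfx' LR (fun _ _ => erefl).
by rewrite /Rintegral => ->.
Qed.

Lemma Rintegral_itv_cst (a b c : R) : a <= b ->
  \int[mu]_(t in `[a, b]) c = c * (b - a).
Proof.
rewrite le_eqVlt => /predU1P[<-|ab].
  by rewrite set_itv1 Rintegral_set1 subrr mulr0.
rewrite Rintegral_cst//; congr (_ * _).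
have mab : mu `[a, b]%classic = (b - a)%:E.
  by rewrite lebesgue_measure_itv/= lte_fin ab EFinB.
exact: (congr1 fine mab).
Qed.

Lemma integrable_itv_cst (a b c : R) : mu.-integrable `[a, b] (EFin \o cst c).
Proof.
apply: continuous_compact_integrable; first exact: segment_compact.
by move=> ?; exact: cst_continuous.
Qed.

(** Cauchy-Schwarz against the constant 1, obtained by integrating [(f t - c) ^+ 2 >= 0] with [c]
    the mean of [f]. *)
Lemma Rintegral_sqr_le (a b : R) (f : R -> R) : a <= b ->
  mu.-integrable `[a, b] (EFin \o f) ->
  mu.-integrable `[a, b] (EFin \o (fun t => f t ^+ 2)) ->
  (\int[mu]_(t in `[a, b]) f t) ^+ 2 <= (b - a) * \int[mu]_(t in `[a, b]) (f t ^+ 2).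
Proof.
rewrite le_eqVlt => /predU1P[<- _ _|ab i1 i2].
  by rewrite set_itv1 !Rintegral_set1 expr0n subrr mul0r.
set I := \int[mu]_(t in `[a, b]) f t; set J := \int[mu]_(t in _) _.
pose c := I / (b - a).
have ba : b - a != 0 by rewrite subr_eq0 gt_eqF.
have : 0 <= \int[mu]_(t in `[a, b]) ((f t ^+ 2 - (2 * c) * f t) + c ^+ 2).
  apply: Rintegral_ge0 => t _.
  suff -> : f t ^+ 2 - 2 * c * f t + c ^+ 2 = (f t - c) ^+ 2 by exact: sqr_ge0.
  by ring.
have i3 : mu.-integrable `[a, b] (EFin \o (fun t => (2 * c) * f t)).
  exact: integrable_itvZ.
have i4 : mu.-integrable `[a, b] (EFin \o (fun t => f t ^+ 2 - (2 * c) * f t)).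
  exact: integrable_itvB.
rewrite (RintegralD _ i4 (integrable_itv_cst a b (c ^+ 2)))//.
rewrite (RintegralB _ i2 i3)// (RintegralZl _ _ i1)//.
rewrite Rintegral_itv_cst ?(ltW ab)//= -/I -/J => H.
have Ic : I = c * (b - a) by rewrite /c mulfVK.
rewrite -subr_ge0.
have : 0 <= (b - a) * (J - 2 * c * I + c ^+ 2 * (b - a)).
  by apply: mulr_ge0 => //; rewrite subr_ge0 ltW.
congr (0 <= _); rewrite Ic; ring.
Qed.

Lemma le_Rintegral_itv (a b c d : R) (f : R -> R) :
  a <= c -> d <= b -> mu.-integrable `[a, b] (EFin \o f) ->
  (forall x, 0 <= f x) ->
  \int[mu]_(t in `[c, d]) f t <= \int[mu]_(t in `[a, b]) f t.
Proof.
move=> ac db intf f0.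
have sub : `[c, d]%classic `<=` `[a, b]%classic.
  by apply: subset_itv; rewrite bnd_simp.
have intf' : mu.-integrable `[c, d] (EFin \o f) by apply: integrableS intf.
rewrite /Rintegral fine_le ?integrable_fin_num//.
apply: ge0_subset_integral => //.
- exact: measurable_int intf.
- by move=> x _; rewrite lee_fin.
Qed.

(** Cauchy-Schwarz on the segment between [x] and [y], then enlarged to [[a, b]]. With [x] a zero of
    [f] it bounds [f ^+ 2] uniformly. *)
Lemma is_primitive_sqr_le (a b : R) (f f' : R -> R) (x y : R) :
  is_primitive a b f f' ->
  mu.-integrable `[a, b] (EFin \o (fun t => f' t ^+ 2)) ->
  x \in `[a, b] -> y \in `[a, b] ->
  (f y - f x) ^+ 2 <= (b - a) * \int[mu]_(t in `[a, b]) (f' t ^+ 2).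
Proof.
move=> Hf i2; wlog xy : x y / x <= y => [H xab yab|].
  have [|/ltW] := leP x y => xy; first exact: H.
  by rewrite -sqrrN opprB; exact: H.
rewrite !in_itv/= => /andP[ax xb] /andP[ay yb].
have sub : `[x, y]%classic `<=` `[a, b]%classic.
  by apply: subset_itv; rewrite bnd_simp.
have [i1 _] := Hf.
rewrite (is_primitiveB Hf ax xy yb).
apply: (le_trans (Rintegral_sqr_le xy _ _)).
- by apply: integrableS i1.
- by apply: integrableS i2.
apply: ler_pM.
- by rewrite subr_ge0.
- by apply: Rintegral_ge0 => t _; exact: sqr_ge0.
- exact: lerB.
- by apply: le_Rintegral_itv => // t; exact: sqr_ge0.
Qed.

End indefinite_integral.

(** * Riccati equation and two-sided bounds on the principal eigenvalue *)

Section principal_eigenvalue_bounds.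
Context {R : realType}.
Notation mu := (@lebesgue_measure R).

Lemma is_derive_derive1 (f : R -> R) (x : R) :
  derivable f x 1 -> is_derive x 1 f (derive1 f x).
Proof. by move=> df; split; [|rewrite derive1E]. Qed.

Lemma derive1_periodic (L : R) (f : R -> R) (x : R) :
  (forall x, derivable f x 1) -> (forall x, f (x + L) = f x) ->
  derive1 f (x + L) = derive1 f x.
Proof.
move=> df per.
have shiftE : f \o (fun y => y + L) = f by apply/funext => y; exact: per.
have : is_derive x (1 : R) (f \o (fun y => y + L)) (derive1 f (x + L) * (1 + 0)).
  apply: is_derive1_comp; first exact: is_derive_derive1.
rewrite shiftE addr0 mulr1 => -[_].
by rewrite -derive1E => ->.
Qed.

Lemma locally_integrable_itv (a b : R) (f : R -> R) :
  locally_integrable setT f -> mu.-integrable `[a, b] (EFin \o f).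
Proof.
move=> [mf _ foo]; apply/integrableP; split.
  by apply/measurable_EFinP; exact: measurable_funTS.
by apply: foo => //; exact: segment_compact.
Qed.

(** The logarithmic derivative of a positive periodic eigenfunction turns the linear second-order
    equation into a first-order Riccati equation. *)
Lemma principal_eigenvalue_riccati (L lambda k : R) (b : R -> R) : 0 < L ->
  mu.-integrable `[0, L] (EFin \o b) ->
  is_principal_eigenvalue L lambda b k ->
  exists2 phi : R -> R,
    [/\ phi L = phi 0, exists2 c, c \in `[0, L] & phi c = 0 &
      \int[mu]_(t in `[0, L]) phi t = 0] &
    is_primitive 0 L phi
      (fun x => - k - lambda ^+ 2 - b x - 2 * lambda * phi x - phi x ^+ 2).
Proof.
move=> L0 intb [psi [psi2 [[dpsi lpsi2 Hpsi2] per pos eqn]]].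
have pos0 x : psi x != 0 by rewrite gt_eqF.
have Pp : is_primitive 0 L (derive1 psi) psi2.
  split; first exact: locally_integrable_itv.
  by move=> x; rewrite in_itv/= => /andP[x0 _]; exact: Hpsi2.
have cp := is_primitive_continuous (ltW L0) Pp.
have cpsi : continuous psi.
  by move=> x; apply: differentiable_continuous; exact/derivable1_diffP.
have cpsi' : {within `[0, L], continuous psi} by exact: continuous_subspaceT.
have cipsi : {within `[0, L], continuous (fun x => (psi x)^-1)}.
  by move=> x; apply: continuousV => //; exact: cpsi'.
pose phi x := derive1 psi x * (psi x)^-1.
have cphi : {within `[0, L], continuous phi}.
  by move=> x; apply: continuousM; [exact: cp|exact: cipsi].
have Pi : is_primitive 0 L (fun x => (psi x)^-1)
    (fun x => - (psi x ^- 2) *: derive1 psi x).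
  apply: is_primitive_C1.
    by move=> x; apply: is_deriveV => //; exact: is_derive_derive1.
  (* In this form the continuity of the derivative follows from that of [phi]. *)
  rewrite (_ : (fun x => - (psi x ^- 2) *: derive1 psi x) =
      (fun x => - ((psi x)^-1 * phi x))); last first.
    apply/funext => y; rewrite /phi /GRing.scale/=; field; exact: pos0.
  by move=> x; apply: cvgN; exact: (continuousM (cipsi x) (cphi x)).
(* [phi] is the derivative of [ln psi], hence has mean zero. *)
have Pln : is_primitive 0 L (fun x => ln (psi x)) phi.
  apply: is_primitive_C1 => // x; rewrite /phi mulrC.
  apply: (@is_derive1_comp _ (@ln R) psi); first exact: is_derive1_ln.
  exact: is_derive_derive1.
have psiL : psi L = psi 0 by rewrite -[L in LHS]add0r per.
exists phi; first split.
- by rewrite /phi psiL -[L in LHS]add0r derive1_periodic.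
(* Rolle's theorem for the periodic [psi] gives a zero of [psi'], hence of [phi]. *)
- have [|c c0L [_ pc]] := Rolle L0 (fun x _ => dpsi x) cpsi'; first by rewrite psiL.
  exists c; first by apply: subset_itv_oo_cc.
  by rewrite /phi derive1E pc mul0r.
- have [_ /(_ L) <-] := Pln; last by rewrite in_itv/= lexx ltW.
  by rewrite psiL subrr.
(* The product rule for [psi' * psi^-1] gives the derivative [psi'' / psi - phi ^+ 2], in which the
   equation then eliminates [psi'']. *)
have P0 := is_primitiveM (ltW L0) Pp Pi.
have iphi : mu.-integrable `[0, L] (EFin \o phi).
  by apply: continuous_compact_integrable => //; exact: segment_compact.
apply: is_primitive_ae P0 _ _.
  apply/measurable_EFinP; apply: (measurable_int mu).
  apply: integrable_itvB; last exact: integrable_continuousM.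
  apply: integrable_itvB; last exact: integrable_itvZ.
  apply: integrable_itvB => //; exact: integrable_itv_cst.
apply: filterS eqn; first exact: (ae_filter_ringOfSetsType mu).
move=> x eqx _.
have -> : psi2 x = - k * psi x - 2 * lambda * derive1 psi x - (b x + lambda ^+ 2) * psi x.
  rewrite mulNr -eqx; ring.
rewrite /phi /GRing.scale/=; field; exact: pos0.
Qed.

(** Here [m] is the mean and [v] the variance of [b] over a period; the two bounds amount to
    [0 <= A <= L ^+ 2 * v], where [A] is the mean of [phi ^+ 2]. *)
Lemma principal_eigenvalue_bounds (L lambda k m v : R) (b : R -> R) : 0 < L ->
  mu.-integrable `[0, L] (EFin \o b) ->
  mu.-integrable `[0, L] (EFin \o (fun x => b x ^+ 2)) ->
  is_principal_eigenvalue L lambda b k ->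
  \int[mu]_(x in `[0, L]) b x = m * L ->
  \int[mu]_(x in `[0, L]) (b x ^+ 2) = (m ^+ 2 + v) * L ->
  lambda ^+ 2 + m <= - k <= lambda ^+ 2 + m + L ^+ 2 * v.
Proof.
move=> L0 intb intb2 /(principal_eigenvalue_riccati L0 intb)[phi []].
move=> phiL [c c0L phic] Iphi; set w := (fun x => _) => Pw.
move=> Ib Ib2.
pose I (f : R -> R) := \int[mu]_(x in `[0, L]) f x.
pose J (f : R -> R) := mu.-integrable `[0, L] (EFin \o f).
have ID f g : J f -> J g -> I (fun x => f x + g x) = I f + I g by exact: RintegralD.
have IB f g : J f -> J g -> I (fun x => f x - g x) = I f - I g by exact: RintegralB.
have IZ r f : J f -> I (fun x => r * f x) = r * I f by exact: RintegralZl.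
have JD f g : J f -> J g -> J (fun x => f x + g x) by exact: integrable_itvD.
have JB f g : J f -> J g -> J (fun x => f x - g x) by exact: integrable_itvB.
have JZ r f : J f -> J (fun x => r * f x) by exact: integrable_itvZ.
have IC r : I (fun=> r) = r * L by rewrite /I Rintegral_itv_cst ?subr0// ltW.
have JC r : J (fun=> r) by exact: integrable_itv_cst.
have cphi := is_primitive_continuous (ltW L0) Pw.
have cont f : {within `[0, L], continuous f} -> J f.
  by apply: continuous_compact_integrable => //; exact: segment_compact.
have Lin : L \in `[0, L] by rewrite in_itv/= lexx ltW.
have Jphi : J phi by exact: cont.
have Jphi2 : J (fun x => phi x ^+ 2) by exact: integrable_continuousM.
have Jw : J w by case: Pw.
have Jphiw : J (fun x => phi x * w x) by exact: integrable_continuousM.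
have Jphi2w : J (fun x => phi x * (phi x * w x)) by exact: integrable_continuousM.
have Iw : I w = 0.
  by have [_ /(_ _ Lin)] := Pw; rewrite phiL subrr.
(* The squares and cubes of [phi] take equal values at 0 and [L], so [phi * w] and [phi ^+ 2 * w]
   have integral zero. *)
have P2 := is_primitiveM (ltW L0) Pw Pw.
have P3 := is_primitiveM (ltW L0) Pw P2.
have Iphiw : I (fun x => phi x * w x) = 0.
  have [_ /(_ _ Lin)] := P2; rewrite phiL subrr => /esym.
  rewrite (_ : (\int[mu]_(t in _) _) = I (fun x => 2 * (phi x * w x))).
    by rewrite IZ// => /eqP; rewrite mulf_eq0 pnatr_eq0/= => /eqP.
  by apply: eq_Rintegral => t _; ring.
have Iphi2w : I (fun x => phi x * (phi x * w x)) = 0.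
  have [_ /(_ _ Lin)] := P3; rewrite phiL subrr => /esym.
  rewrite (_ : (\int[mu]_(t in _) _) = I (fun x => 3 * (phi x * (phi x * w x)))).
    by rewrite IZ// => /eqP; rewrite mulf_eq0 pnatr_eq0/= => /eqP.
  by apply: eq_Rintegral => t _; ring.
pose A := - k - lambda ^+ 2 - m.
have AL : A * L = I (fun x => phi x ^+ 2).
  have : I w = (- k - lambda ^+ 2) * L - m * L
      - 2 * lambda * I phi - I (fun x => phi x ^+ 2).
    rewrite /w IB//; last by apply/JB; [exact: JB|exact: JZ].
    rewrite IB//; [|exact: JB|exact: JZ].
    by rewrite IB// IC IZ// [I (fun x => b x)]Ib.
  rewrite Iw (_ : I phi = 0)// mulr0 subr0 => /esym/eqP.
  rewrite subr_eq0 => /eqP <-; rewrite /A; ring.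
(* Thus [w = q - (b - m)], and [q] is a polynomial in [phi], which makes [q * w] integrate to
   zero. *)
pose q x := A - 2 * lambda * phi x - phi x ^+ 2.
have cq : {within `[0, L], continuous q}.
  have cC (r : R) : {within `[0, L], continuous (fun _ : R => r)}.
    by apply: continuous_subspaceT; exact: cst_continuous.
  have cM (f g : R -> R) : {within `[0, L], continuous f} ->
      {within `[0, L], continuous g} ->
      {within `[0, L], continuous (fun x => f x * g x)}.
    by move=> cf cg x; exact: (continuousM (cf x) (cg x)).
  have cB (f g : R -> R) : {within `[0, L], continuous f} ->
      {within `[0, L], continuous g} ->
      {within `[0, L], continuous (fun x => f x - g x)}.
    by move=> cf cg x; exact: (continuousB (cf x) (cg x)).
  by apply/cB/cM => //; apply/cB/cM.
have Jqw : J (fun x => q x * w x) by exact: integrable_continuousM.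
have Jq2 : J (fun x => q x * q x) by apply: integrable_continuousM => //; exact: cont.
have Iqw : I (fun x => q x * w x) = 0.
  rewrite (_ : (fun x => q x * w x) =
      (fun x => A * w x - 2 * lambda * (phi x * w x) - phi x * (phi x * w x))).
    rewrite IB//; last by apply/JB; exact: JZ.
    rewrite IB; [|exact: JZ|exact: JZ].
    by rewrite !IZ// Iw Iphiw Iphi2w !mulr0 !subr0.
  by apply/funext => x; rewrite /q; ring.
(* This expands [(b - m) ^+ 2 = (q - w) ^+ 2]. It also yields the integrability of [w ^+ 2], so far
   known only for [w]. *)
have w2E : (fun x => w x ^+ 2) =
    (fun x => (b x ^+ 2 - 2 * m * b x + m ^+ 2) + 2 * (q x * w x) - q x * q x).
  by apply/funext => x; rewrite /w /q /A; ring.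
have Jv : J (fun x => b x ^+ 2 - 2 * m * b x + m ^+ 2).
  by apply: JD => //; apply: JB => //; exact: JZ.
have Jw2 : J (fun x => w x ^+ 2).
  by rewrite w2E; apply: JB => //; apply: JD => //; exact: JZ.
have Iw2 : I (fun x => w x ^+ 2) <= L * v.
  rewrite w2E IB//; last by apply: JD => //; exact: JZ.
  rewrite ID//; last exact: JZ.
  rewrite IZ// Iqw mulr0 addr0 ID//; last by apply: JB => //; exact: JZ.
  rewrite IB//; last exact: JZ.
  rewrite IZ// IC.
  have -> : I (fun x => b x ^+ 2) - 2 * m * I b + m ^+ 2 * L = L * v.
    rewrite [I b]Ib [I _]Ib2; ring.
  rewrite lerBlDr lerDl; apply: Rintegral_ge0 => x _; rewrite -expr2; exact: sqr_ge0.
(* Since [phi c = 0], pointwise [phi ^+ 2] is at most [L] times the integral of [w ^+ 2], hence at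
   most [L ^+ 2 * v]. *)
have AL_le : A * L <= L ^+ 2 * v * L.
  rewrite AL -[leRHS]IC; apply: le_Rintegral => //; first exact: JC.
  move=> x x0L.
  have := is_primitive_sqr_le Pw Jw2 c0L x0L; rewrite phic !subr0 => /le_trans; apply.
  by rewrite expr2 -mulrA ler_wpM2l// ltW.
have A0 : 0 <= A * L.
  by rewrite AL; apply: Rintegral_ge0 => x _; exact: sqr_ge0.
move: A0 AL_le; rewrite pmulr_lge0// ler_pM2r// /A => A0 A1.
apply/andP; split; lra.
Qed.

End principal_eigenvalue_bounds.

(** * Translations and almost-everywhere periodicity *)

Section ae_translation.
Context {R : realType}.
Notation mu := (@lebesgue_measure R).

(** By uniqueness of Lebesgue measure, it suffices to compare the two measures on half-open
    intervals. *)
Lemma lebesgue_measure_translation (c : R) (A : set R) : measurable A ->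
  pushforward mu ((fun x => x + c) : _ -> measurableTypeR R) A = mu A.
Proof.
move=> mA; apply/esym/lebesgue_measure_unique => //=; first exact: measurable_funD.
move=> _ _ [[a b]] _ <-.
rewrite /pushforward/=.
rewrite (_ : _ @^-1` _ = `]a - c, b - c]%classic); last first.
  by apply/seteqP; split=> x /=; rewrite !in_itv/= ltrBlDr lerBrDr.
rewrite !lebesgue_measure_itv/= !lte_fin ltrD2r.
by rewrite -!EFinB opprB addrA subrK.
Qed.

Lemma ae_translation (c : R) (P : R -> Prop) :
  {ae mu, forall x, P x} -> {ae mu, forall x, P (x + c)}.
Proof.
move=> [N [mN N0 PN]]; exists ((fun x => x + c) @^-1` N); split.
- rewrite -[X in measurable X]setTI.
  by apply: (_ : measurable_fun setT (fun x : R => x + c)) => //; exact: measurable_funD.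
- by have := lebesgue_measure_translation c mN; rewrite /pushforward => ->.
- by move=> x; exact: (PN (x + c)).
Qed.

(** Periodicity may fail on a null set, so it cannot be iterated at a fixed point; countably many
    translated null sets are discarded first. *)
Lemma ae_periodic_cst (L s : R) (b : R -> R) : 0 < L -> ae_periodic L b ->
  {ae mu, forall x, x \in `[0, L] -> b x = s} -> {ae mu, forall x, b x = s}.
Proof.
move=> L0 perb bs.
have fltr := ae_filter_ringOfSetsType mu.
have H : {ae mu, forall x, forall n : nat,
    (b (x + n%:R * L + L) = b (x + n%:R * L) /\
     b (x - n%:R * L + L) = b (x - n%:R * L)) /\
    ((x + n%:R * L \in `[0, L] -> b (x + n%:R * L) = s) /\
     (x - n%:R * L \in `[0, L] -> b (x - n%:R * L) = s))}.
  apply: ae_foralln => n.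
  by apply: filterI; apply: filterI;
    apply: (@ae_translation _ (fun y => b (y + L) = b y)) ||
    apply: (@ae_translation _ (fun y => y \in `[0, L] -> b y = s)).
apply: filterS H => x H.
have up n : b (x + n%:R * L) = b x.
  elim: n => [|n IH]; first by rewrite mul0r addr0.
  by have [[+ _] _] := H n; rewrite -natr1 mulrDl mul1r addrA IH.
have down n : b (x - n%:R * L) = b x.
  elim: n => [|n IH]; first by rewrite mul0r subr0.
  (* The index is [n.+1] because periodicity is applied at the left point [x - n.+1%:R * L]. *)
  have [[_ +] _] := H n.+1; rewrite -{1}natr1 mulrDl mul1r opprD addrA subrK IH.
  by rewrite -natr1 mulrDl mul1r opprD addrA => <-.
pose n := Num.floor (x / L).
have xn : x - n%:~R * L \in `[0, L].
  rewrite in_itv/= subr_ge0 -ler_pdivlMr// Num.Theory.floor_le//=.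
  rewrite lerBlDr -[X in X + _]mul1r -mulrDl -ler_pdivrMr// addrC ltW//.
  by have := Num.Theory.floorD1_gt (x / L); rewrite intrD.
(* A negative [Negz n] stands for [- n.+1], hence the shift by [n.+1] periods in the second case. *)
case: n xn => n xn.
- by rewrite -(down n); have [_ [_]] := H n; apply.
- rewrite -(up n.+1); have [_ [+ _]] := H n.+1; apply.
  by move: xn; rewrite NegzE mulrNz mulNr opprK.
Qed.

End ae_translation.

(** * Minimal speed of constants and rigidity of maximizers *)

Section minimal_speed.
Context {R : realType}.
Notation mu := (@lebesgue_measure R).

Lemma locally_integrable_cst (c : R) : locally_integrable setT (fun _ : R => c).
Proof.
split => [||K _ cK]; [exact: measurable_cst|exact: openT|].
rewrite integral_cst; last exact: compact_measurable.
by rewrite lte_mul_pinfty// compact_finite_measure.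
Qed.

(** The constant 1 is an eigenfunction, and uniqueness comes from [principal_eigenvalue_bounds] with
    zero variance, where the two bounds coincide. *)
Lemma principal_eigenvalue_cst (L lambda s : R) : 0 < L ->
  principal_eigenvalue L lambda (fun=> s) = - (lambda ^+ 2 + s).
Proof.
move=> L0; apply: xget_subset1.
  exists (cst 1), (cst 0); split => //.
  - split; first by move=> x; exact: derivable_cst.
      exact: locally_integrable_cst.
    by move=> x y _; rewrite !derive1_cst subrr Rintegral_cst// mul0r.
  - apply: aeW => x; rewrite derive1_cst/=; ring.
have Hk k : is_principal_eigenvalue L lambda (fun=> s) k -> - k = lambda ^+ 2 + s.
  move=> /(principal_eigenvalue_bounds (m := s) (v := 0) L0).
  rewrite !Rintegral_itv_cst ?(ltW L0)// subr0 addr0 mulr0 addr0.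
  move=> /(_ (integrable_itv_cst _ _ _) (integrable_itv_cst _ _ _) erefl erefl).
  by move/le_anti.
by move=> k1 k2 /Hk h1 /Hk h2; apply: oppr_inj; rewrite h1.
Qed.

(** The speeds are [(l ^+ 2 + s) / l]; the minimum is at [l = Num.sqrt s], by
    [(l - Num.sqrt s) ^+ 2 >= 0]. *)
Lemma minimal_speed_cst (L s : R) : 0 < L -> 0 < s ->
  minimal_speed L (fun=> s) = 2 * Num.sqrt s.
Proof.
move=> L0 s0.
have q0 : 0 < Num.sqrt s by rewrite sqrtr_gt0.
have q2 : Num.sqrt s ^+ 2 = s by rewrite sqr_sqrtr// ltW.
apply: xget_subset1; last first.
  move=> x y [Sx lbx] [Sy lby]; apply/eqP.
  by rewrite eq_le lbx// lby.
split.
  exists (Num.sqrt s) => //.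
  rewrite principal_eigenvalue_cst// opprK q2 -{1 2}q2; field.
  by rewrite gt_eqF.
move=> _ [l l0 <-]; rewrite principal_eigenvalue_cst// opprK.
rewrite ler_pdivlMr// -{2}q2 -subr_ge0.
rewrite (_ : _ - _ = (l - Num.sqrt s) ^+ 2) ?sqr_ge0//; ring.
Qed.

(* A positive minimal speed cannot come from the dummy values in [minimal_speed]
   and [principal_eigenvalue], so no existence theory for eigenvalues is needed. *)
Lemma minimal_speed_le (L lambda : R) (b : R -> R) :
  0 < minimal_speed L b -> 0 < lambda ->
  exists2 k, is_principal_eigenvalue L lambda b k &
    minimal_speed L b <= - k / lambda.
Proof.
rewrite /minimal_speed; set S := _ `&` _.
have [[c Sc]|noS] := pselect (S !=set0); last first.
  rewrite xgetPN ?ltxx// => c Sc; apply: noS; by exists c.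
have [_ lb] := @xgetPex _ 0 S (ex_intro _ c Sc); move=> c0 l0.
have le : xget 0 S <= - principal_eigenvalue L lambda b / lambda.
  by apply: lb; exists lambda.
exists (principal_eigenvalue L lambda b) => //.
have [[k Hk]|nok] := pselect (exists k, is_principal_eigenvalue L lambda b k).
  exact: (xgetPex 0 (ex_intro _ k Hk)).
have pe0 : principal_eigenvalue L lambda b = 0.
  by apply: xgetPN => k Hk; apply: nok; exists k.
by move: le; rewrite pe0 oppr0 mul0r leNgt c0.
Qed.

Lemma A2_cst (L beta : R) : 0 < L -> 0 <= beta -> A2 L beta (fun=> Num.sqrt beta).
Proof.
move=> L0 b0; split.
- exact: locally_integrable_cst.
- exact: aeW.
- by apply: aeW => x; exact: sqrtr_ge0.
- have muL : mu `[0, L]%classic = L%:E.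
    by rewrite lebesgue_measure_itv/= lte_fin L0 oppr0 adde0.
  rewrite sqr_sqrtr// integral_cst// [X in (_ * (_ * X))%E](_ : _ = L%:E)//.
  rewrite -!EFinM.
  by rewrite mulrCA mulVf ?mulr1// gt_eqF.
Qed.

Lemma speed_maximizer_cst (L beta : R) (b : R -> R) :
  0 < L -> 0 < beta -> L ^+ 2 * (2 * Num.sqrt beta) < 1 ->
  is_speed_maximizer L beta b ->
  {ae mu, forall x, b x = Num.sqrt beta}.
Proof.
move=> L0 beta0 Lsmall [[lb perb _ intb2] bmax].
set s := Num.sqrt beta in Lsmall *.
have s0 : 0 < s by rewrite sqrtr_gt0.
have s2 : s ^+ 2 = beta by rewrite sqr_sqrtr// ltW.
have ib := @locally_integrable_itv R 0 L _ lb.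
have mb : measurable_fun `[0, L] b.
  by case: lb => mb _ _; exact: measurable_funTS.
(* The normalization in [A2] is an equality of extended reals, so it forces the integral of [b ^+ 2]
   to be finite. *)
have Eb2 : (\int[mu]_(x in `[0%R, L]) ((b x) ^+ 2)%:E)%E = (beta * L)%:E.
  have := congr1 (fun z => L%:E * z)%E intb2.
  by rewrite muleA -EFinM divff ?gt_eqF// mul1e => ->; rewrite -EFinM mulrC.
have ib2 : mu.-integrable `[0, L] (EFin \o (fun x => b x ^+ 2)).
  apply/integrableP; split.
    by apply/measurable_EFinP; exact: measurable_funX.
  rewrite [X in (X < _)%E](_ : _ = (beta * L)%:E) ?ltry// -Eb2.
  by apply: eq_integral => x _; rewrite /= ger0_norm// sqr_ge0.
have Ib2 : \int[mu]_(x in `[0, L]) (b x ^+ 2) = beta * L.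
  by rewrite /Rintegral Eb2.
pose m := (\int[mu]_(x in `[0, L]) b x) / L.
have Ib : \int[mu]_(x in `[0, L]) b x = m * L by rewrite /m divfK// gt_eqF.
have m2 : m ^+ 2 <= beta.
  have := Rintegral_sqr_le (ltW L0) ib ib2.
  rewrite Ib Ib2 subr0 exprMn (_ : L * _ = beta * L ^+ 2); last by ring.
  by rewrite ler_pM2r// exprn_gt0.
have ms : m <= s.
  by rewrite (le_trans (ler_norm _))// -sqrtr_sqr ler_wsqrtr.
have q0 : 0 < Num.sqrt s by rewrite sqrtr_gt0.
have q2 : Num.sqrt s ^+ 2 = s by rewrite sqr_sqrtr// ltW.
have := bmax _ (A2_cst L0 (ltW beta0)); rewrite minimal_speed_cst// => c2.
have c0 : 0 < minimal_speed L b by apply: lt_le_trans c2; rewrite mulr_gt0.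
(* The test value is [lambda = Num.sqrt s], optimal for the constant [s]; there
   [2 * Num.sqrt s <= - k / lambda] becomes [2 * s <= - k]. *)
have [k Hk ck] := minimal_speed_le c0 q0.
have k2 : 2 * s <= - k.
  have := le_trans c2 ck; rewrite ler_pdivlMr//.
  by rewrite -mulrA -expr2 q2.
have /andP[_] := principal_eigenvalue_bounds (m := m) (v := beta - m ^+ 2) L0 ib ib2 Hk Ib
  (etrans Ib2 (congr1 ( *%R^~ L) (esym (subrKC _ _)))).
rewrite q2 => k3.
have ms_eq : m = s.
  apply/eqP; rewrite eq_le ms /= leNgt; apply/negP => mlts.
  (* As [beta = s ^+ 2], this says [s - m > L ^+ 2 * (beta - m ^+ 2)], contrary to [k2] and [k3]. *)
  have : 0 < (s - m) * (1 - L ^+ 2 * (s + m)).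
    rewrite mulr_gt0 ?subr_gt0//; apply: le_lt_trans Lsmall.
    by rewrite ler_wpM2l ?sqr_ge0// mulr_natl mulr2n lerD2l.
  rewrite (_ : _ * _ = s - m - L ^+ 2 * (beta - m ^+ 2)); last by rewrite -s2; ring.
  by move=> H; move: (le_trans k2 k3); lra.
apply: (ae_periodic_cst L0 perb).
have i3 := integrable_itvB ib2 (integrable_itvZ (2 * s) ib).
have ic := @integrable_itv_cst R 0 L (s ^+ 2).
(* With mean [s] and mean square [s ^+ 2], the nonnegative [(b - s) ^+ 2] integrates to zero, so it
   vanishes almost everywhere. *)
pose g x := b x ^+ 2 - 2 * s * b x + s ^+ 2.
have gE x : g x = (b x - s) ^+ 2 by rewrite /g; ring.
have I0 : \int[mu]_(x in `[0, L]) g x = 0.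
  rewrite (RintegralD _ i3 ic)//.
  rewrite (RintegralB _ ib2 (integrable_itvZ (2 * s) ib))//.
  rewrite (RintegralZl _ _ ib)// Ib Ib2 ms_eq -s2.
  rewrite Rintegral_itv_cst ?(ltW L0)//; ring.
have i4 : mu.-integrable `[0, L] (EFin \o g) by exact: integrable_itvD i3 ic.
have : (\int[mu]_(x in `[0%R, L]) `|(EFin \o g) x|)%E = 0%E.
  transitivity (\int[mu]_(x in `[0%R, L]) (EFin \o g) x)%E.
    by apply: eq_integral => x _; rewrite /= gE ger0_norm// sqr_ge0.
  rewrite -[LHS]fineK ?integrable_fin_num//.
  by rewrite [fine _]I0.
have mg := measurable_int mu i4.
move/(ae_eq_integral_abs mu (measurable_itv _) mg) => ae0.
apply: filterS ae0 => x H /H/= [] /eqP.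
by rewrite gE sqrf_eq0 subr_eq0 => /eqP.
Qed.

Lemma C2_norm_ae0 (u : R -> R) : {ae mu, forall x, u x = 0} ->
  (C2_norm u <= 0)%E.
Proof.
move=> u0; apply: ereal_inf_lbound => /=.
have d0 : derive1 (cst 0 : R -> R) = cst 0.
  by apply/funext => x; rewrite derive1_cst.
have d20 : derive1n 2 (cst 0 : R -> R) = cst 0 by rewrite derive1nS derive1n1 !d0.
exists (cst 0).
  split.
    split; rewrite ?d20 ?d0; last exact: cst_continuous.
    - by move=> x; exact: derivable_cst.
    - by move=> x; exact: derivable_cst.
  by apply: filterS u0; [exact: (ae_filter_ringOfSetsType mu)|move=> x ->].
have L0 : Linfty_norm (cst 0 : R -> R) = 0%E by exact: Lnorm0.
by rewrite !d0 !L0 !adde0.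
Qed.

End minimal_speed.

Theorem theorem2p9 (R : realType) (beta : R) (hbeta : 0 < beta)
    (b : R -> R -> R)
    (hb : forall L : R, 0 < L -> is_speed_maximizer L beta (b L))
    (k : nat) :
  exists C : R, \forall L \near (0 : R)^'+,
    (C2_norm (fun x : R => (b L x - Num.sqrt beta)%R) <= (C * L ^+ k)%:E)%E.
Proof.
set s := Num.sqrt beta.
have d0 : 0 < 2 * s + 1 by rewrite ltr_wpDl// mulr_ge0// sqrtr_ge0.
(* The constant 0 works for every [k]: for small [L] the difference vanishes almost everywhere. *)
exists 0; near=> L.
have L0 : 0 < L by near: L; exact: nbhs_right_gt.
have L1 : L < 1 by near: L; exact: nbhs_right_lt.
have Ls : L < (2 * s + 1)^-1 by near: L; apply: nbhs_right_lt; rewrite invr_gt0.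
have Lsmall : L ^+ 2 * (2 * s) < 1.
  have L2 : L ^+ 2 <= L by rewrite expr2 ger_pMl// ltW.
  apply: le_lt_trans (_ : L * (2 * s + 1) < 1).
    by apply: ler_pM; rewrite ?sqr_ge0 ?mulr_ge0 ?sqrtr_ge0 ?lerDl.
  by rewrite -ltr_pdivlMr// div1r.
rewrite mul0r; apply: C2_norm_ae0.
apply: filterS (speed_maximizer_cst L0 hbeta Lsmall (hb L L0)).
  exact: (ae_filter_ringOfSetsType (@lebesgue_measure R)).
by move=> x ->; rewrite subrr.
Unshelve. all: by end_near. Qed.
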